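(* (Type $q$-P$(A_6)^\#$.) Let $Y(x)={}^t(y_1(x),y_2(x))$ be meromorphic on $\mathbb{C}^*$ and satisfy $Y(qx)=A(x)Y(x)$ with the matrix $A(x)$ of the context, and suppose $\lambda=a_3$. Then $$y_1(q^2x)-(q^2\kappa_1x^2-dx+\theta_1t)y_1(qx)+\kappa_1\kappa_2x^2(qx-a_3)y_1(x)=0,\qquad d=q\kappa_1a_3+\frac{q\theta_1t}{a_3}-\frac{a_3}{\mu}.$$ Moreover, if $u$ is a meromorphic function on $\mathbb{C}^*$, not identically zero, with $u(qx)=(qx-a_3)u(x)$, then $f(x)=y_1(qx)/u(qx)$ satisfies $$(q^2x-a_3)f(qx)-(q^2\kappa_1x^2-dx+\theta_1t)f(x)+\kappa_1\kappa_2x^2f(x/q)=0.$$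
   Context: Let $q,t,\kappa_1,\kappa_2,a_3,\theta_1,\lambda,\mu,\omega$ be nonzero complex numbers. The matrix is $$A(x)=\begin{pmatrix}\kappa_1\{(x-\lambda)(x-\alpha)+\mu_1\}&\omega(x-\lambda)\\ \kappa_1\omega^{-1}(\gamma x+\delta)&\kappa_2(x-\lambda)+\mu_2\end{pmatrix},$$ $$\mu_1=\frac{\lambda^2}{q\kappa_1\mu},\quad \mu_2=q\kappa_1\kappa_2\mu(\lambda-a_3),\quad \alpha=\frac{\lambda^{-1}(\theta_1t-\kappa_1\mu_1-\mu_2)+\kappa_2}{\kappa_1},$$ $$\gamma=\mu_2-\kappa_2(2\lambda+\alpha-a_3),\quad \delta=\lambda^{-1}(\alpha\lambda+\mu_1)(\kappa_2\lambda-\mu_2).$$ (This is the linear system of Murata's Lax form for the $q$-Painlevé equation of type $A_6^\#$; it satisfies $\det A(x)=\kappa_1\kappa_2x^2(x-a_3)$.) Equations are understood as identities of meromorphic functions. *)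

(* Defs.v *)
From Stdlib Require Import Reals.
From Coquelicot Require Import Coquelicot.

Open Scope C_scope.

(* Functions are total maps C -> C; the values taken at poles (and at 0) are
   irrelevant, since both [meromorphic_at] and [meq] only look at punctured
   neighbourhoods of points of C^*. *)

Definition analytic_at (f : C -> C) (z0 : C) : Prop :=
  exists a : nat -> C,
    locally z0 (fun z : C =>
      @is_pseries C_AbsRing C_NormedModule a (z - z0) (f z)).

Definition meromorphic_at (f : C -> C) (z0 : C) : Prop :=
  exists (n : nat) (g : C -> C),
    analytic_at g z0 /\ locally' z0 (fun z : C => f z = g z / (z - z0) ^ n).

Definition meromorphic_Cstar (f : C -> C) : Prop :=
  forall z0 : C, z0 <> 0 -> meromorphic_at f z0.

(* Identity of meromorphic functions on C^*: equality off a closed discrete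
   subset of C^*.  [V] is C, or a space of matrices over C. *)
Definition meq {V : Type} (f g : C -> V) : Prop :=
  forall z0 : C, z0 <> 0 -> locally' z0 (fun z : C => f z = g z).

Definition lax_A (q t kappa1 kappa2 a3 theta1 lambda mu omega x : C) :
    @matrix C 2 2 :=
  let mu1 := lambda ^ 2 / (q * kappa1 * mu) in
  let mu2 := q * kappa1 * kappa2 * mu * (lambda - a3) in
  let alpha :=
    (/ lambda * (theta1 * t - kappa1 * mu1 - mu2) + kappa2) / kappa1 in
  let gamma := mu2 - kappa2 * (2 * lambda + alpha - a3) in
  let delta := / lambda * (alpha * lambda + mu1) * (kappa2 * lambda - mu2) in
  [[ kappa1 * ((x - lambda) * (x - alpha) + mu1), omega * (x - lambda) ],
   [ kappa1 * / omega * (gamma * x + delta), kappa2 * (x - lambda) + mu2 ]].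

Definition col2 (a b : C) : @matrix C 2 1 := [[ a ], [ b ]].

(* Main.v *)
Require Import Defs.
From Stdlib Require Import Reals.
From Coquelicot Require Import Coquelicot.
Open Scope C_scope.

(** At [lambda = a3] the second column of [A(x)] is [(x - a3)] times
    [(omega, kappa2)], so [kappa2 y1(qx) - omega y2(qx)] is a multiple of
    [y1(x)] alone, namely [kappa1 kappa2 x^2 y1(x)].  Substituting this into the
    first row of the system at [qx] eliminates [y2].  Dividing the resulting
    equation by [u(qx)] and using the equation for [u] at [x] and at [qx] gives
    the equation for [f]. *)

(** Serves to discard the roots of [q * x - a3] and [q ^ 2 * x - a3], which must be nonzero when
    dividing by values of [u]. *)
Lemma locally'_neq (z c : C) : locally' z (fun w : C => w <> c).
Proof.
destruct (Ceq_dec c z) as [-> | ne].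
{ now exists (mkposreal 1 Rlt_0_1). }
(* Balls of [C] are squares, so a ball of radius r only bounds [Cmod] by [sqrt 2 * r]; hence the
   divisor [sqrt 2]. *)
assert (hpos : (0 < Cmod (minus c z) / sqrt 2)%R).
{ apply Rdiv_lt_0_compat; [|apply Rlt_sqrt2_0].
  apply Cmod_gt_0. intros e. apply ne.
  replace c with (minus c z + z) by (unfold minus, plus, opp; simpl; ring).
  rewrite e; ring. }
exists (mkposreal _ hpos). intros w hw _ ->.
apply C_NormedModule_mixin_compat2 in hw. simpl in hw.
replace (sqrt 2 * (Cmod (minus c z) / sqrt 2))%R with (Cmod (minus c z)) in hw.
- exact (Rlt_irrefl _ hw).
- field. apply Rgt_not_eq, Rlt_sqrt2_0.
Qed.

(** Multiplication by [q] is continuous, and injective since [q <> 0], so it maps points near [z]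
    but distinct from it to such points for [q * z]. *)
Lemma locally'_Cmult (q z : C) (P : C -> Prop) :
  q <> 0 -> locally' (q * z) P -> locally' z (fun w : C => P (q * w)).
Proof.
intros hq H.
pose proof (@filterlim_scal_r C_AbsRing C_NormedModule q z _ H) as G.
change (locally (T := C_UniformSpace) z
  (fun w : C => q * w <> q * z -> P (q * w))) in G.
unfold locally', within. revert G. apply filter_imp. intros w Hw ne. apply Hw. intros e. apply ne. change (w = z :> C).
replace w with (/ q * (q * w)) by (field; exact hq).
rewrite e. field; exact hq.
Qed.

Lemma meq_Cmult {V : Type} (q : C) (g h : C -> V) :
  q <> 0 -> meq g h -> meq (fun x => g (q * x)) (fun x => h (q * x)).
Proof.
intros hq H z hz.
apply (locally'_Cmult q z (fun w => g w = h w) hq).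
now apply H, Cmult_neq_0.
Qed.

Lemma Mmult_col2 (a b c d u v u' v' : C) :
  col2 u v = Mmult ([[a, b], [c, d]] : @matrix C 2 2) (col2 u' v') ->
  u = a * u' + b * v' /\ v = c * u' + d * v'.
Proof.
intros H. split.
- apply (f_equal (fun M : @matrix C 2 1 => coeff_mat (RtoC 0) M 0 0)) in H.
  unfold Mmult in H. rewrite coeff_mat_bij in H by auto.
  simpl Init.Nat.pred in H. rewrite sum_Sn, sum_O in H. exact H.
- apply (f_equal (fun M : @matrix C 2 1 => coeff_mat (RtoC 0) M 1 0)) in H.
  unfold Mmult in H. rewrite coeff_mat_bij in H by auto.
  simpl Init.Nat.pred in H. rewrite sum_Sn, sum_O in H. exact H.
Qed.

Lemma Cdiv_root (p a x : C) : p <> 0 -> p * x - a = 0 -> x = a / p.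
Proof.
intros hp e. replace a with (p * x - (p * x - a)) by ring.
rewrite e. field. exact hp.
Qed.

Lemma Cdiv_0_r (z : C) : z / 0 = 0.
Proof.
(* Both components of the complex inverse of 0 have numerator 0, so they vanish whatever the real
   inverse of 0 is. *)
unfold Cdiv, Cinv, Cmult, RtoC; simpl. f_equal; unfold Rdiv; ring.
Qed.

(* [X], [Y] are the values of [y1], [y2] at [x], and likewise [X1], [Y1] at
   [q x] and [X2], [Y2] at [q^2 x]. *)
Lemma lax_A_elim (q t kappa1 kappa2 a3 theta1 mu omega x X Y X1 Y1 X2 Y2 : C) :
  q <> 0 -> kappa1 <> 0 -> a3 <> 0 -> mu <> 0 -> omega <> 0 ->
  col2 X1 Y1 =
    Mmult (lax_A q t kappa1 kappa2 a3 theta1 a3 mu omega x) (col2 X Y) ->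
  col2 X2 Y2 =
    Mmult (lax_A q t kappa1 kappa2 a3 theta1 a3 mu omega (q * x))
      (col2 X1 Y1) ->
  X2 - (q ^ 2 * kappa1 * x ^ 2
        - (q * kappa1 * a3 + q * theta1 * t / a3 - a3 / mu) * x
        + theta1 * t) * X1
     + kappa1 * kappa2 * x ^ 2 * (q * x - a3) * X = 0.
Proof.
intros hq hk1 ha3 hmu hom H1 H2.
apply Mmult_col2 in H1. apply Mmult_col2 in H2.
destruct H1 as [eX1 eY1], H2 as [eX2 _].
(* Here [mu2 = 0] and [gamma * x + delta = kappa2 * ((x - a3) * (x - alpha) + mu1 - x ^ 2)], so only
   the [x ^ 2] term survives. *)
assert (elim : omega * Y1 = kappa2 * X1 - kappa1 * kappa2 * x ^ 2 * X).
{ rewrite eX1, eY1. field. repeat split; assumption. }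
(* The first row at [q * x], grouped so that [Y1] occurs only in the product [omega * Y1] given by
   [elim]. *)
assert (eX2' : X2 = kappa1 *
   ((q * x - a3) *
      (q * x - (/ a3 * (theta1 * t - kappa1 * (a3 ^ 2 / (q * kappa1 * mu))
                - q * kappa1 * kappa2 * mu * (a3 - a3)) + kappa2) / kappa1)
    + a3 ^ 2 / (q * kappa1 * mu)) * X1 + (q * x - a3) * (omega * Y1)).
{ rewrite eX2. ring. }
rewrite eX2', elim. field. repeat split; assumption.
Qed.

(* [U], [U1], [U2] are the values of [u] at [x], [q x], [q^2 x].  If [U1 = 0]
   all the quotients are junk values equal to [0], so that no identity theorem
   for [u] is needed. *)
Lemma quotient_equation (p b c m U U1 U2 X X1 X2 : C) :
  p <> 0 -> m <> 0 -> U1 = m * U -> U2 = p * U1 ->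
  X2 - b * X1 + c * m * X = 0 ->
  p * (X2 / U2) - b * (X1 / U1) + c * (X / U) = 0.
Proof.
intros hp hm -> -> H.
destruct (Ceq_dec U 0) as [-> | hU].
- rewrite !Cmult_0_r, !Cdiv_0_r. ring.
- transitivity ((X2 - b * X1 + c * m * X) / (m * U)).
  + field. repeat split; assumption.
  + rewrite H. field. repeat split; assumption.
Qed.

Theorem mainTheorem7 :
  forall q t kappa1 kappa2 a3 theta1 lambda mu omega : C,
  q <> 0 -> t <> 0 -> kappa1 <> 0 -> kappa2 <> 0 -> a3 <> 0 ->
  theta1 <> 0 -> lambda <> 0 -> mu <> 0 -> omega <> 0 ->
  forall y1 y2 : C -> C,
  meromorphic_Cstar y1 -> meromorphic_Cstar y2 ->
  meq (fun x => col2 (y1 (q * x)) (y2 (q * x)))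
      (fun x => Mmult (lax_A q t kappa1 kappa2 a3 theta1 lambda mu omega x)
                      (col2 (y1 x) (y2 x))) ->
  lambda = a3 ->
  let d := q * kappa1 * a3 + q * theta1 * t / a3 - a3 / mu in
  meq (fun x =>
         y1 (q ^ 2 * x)
         - (q ^ 2 * kappa1 * x ^ 2 - d * x + theta1 * t) * y1 (q * x)
         + kappa1 * kappa2 * x ^ 2 * (q * x - a3) * y1 x)
      (fun _ => 0)
  /\
  (forall u : C -> C,
   meromorphic_Cstar u ->
   ~ meq u (fun _ => 0) ->
   meq (fun x => u (q * x)) (fun x => (q * x - a3) * u x) ->
   forall f : C -> C,
   meq f (fun x => y1 (q * x) / u (q * x)) ->
   meq (fun x =>
          (q ^ 2 * x - a3) * f (q * x)
          - (q ^ 2 * kappa1 * x ^ 2 - d * x + theta1 * t) * f x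
          + kappa1 * kappa2 * x ^ 2 * f (x / q))
       (fun _ => 0)).
Proof.
intros q t kappa1 kappa2 a3 theta1 lambda mu omega
  hq _ hk1 _ ha3 _ _ hmu hom y1 y2 _ _ Hy -> d.
assert (E1 : meq (fun x =>
   y1 (q ^ 2 * x) - (q ^ 2 * kappa1 * x ^ 2 - d * x + theta1 * t) * y1 (q * x)
   + kappa1 * kappa2 * x ^ 2 * (q * x - a3) * y1 x) (fun _ => 0)).
{ intros z hz.
  generalize (filter_and _ _ (Hy z hz) (meq_Cmult q _ _ hq Hy z hz)).
  apply filter_imp. intros x [H1 H2].
  replace (q ^ 2 * x) with (q * (q * x)) by ring.
  exact (lax_A_elim _ _ _ _ _ _ _ _ _ _ _ _ _ _ _ hq hk1 ha3 hmu hom H1 H2). }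
split; [exact E1|].
intros u _ _ Hu f Hf z hz.
assert (hiq : / q <> 0) by (intros e; apply C1_nz; rewrite <- (Cinv_r q hq), e; ring).
(* All facts needed at one generic [x]: the equation for [y1], that of [u] at [x] and [q * x], the
   definition of [f] at [x], [q * x] and [x / q], and the two excluded roots. *)
generalize (filter_and _ _ (E1 z hz)
  (filter_and _ _ (filter_and _ _ (Hu z hz) (meq_Cmult q _ _ hq Hu z hz))
  (filter_and _ _ (filter_and _ _ (Hf z hz) (meq_Cmult q _ _ hq Hf z hz))
  (filter_and _ _ (meq_Cmult (/ q) _ _ hiq Hf z hz)
  (filter_and _ _ (locally'_neq z (a3 / q)) (locally'_neq z (a3 / q ^ 2))))))).
apply filter_imp.
intros x [H [[U1 U2] [[F0 F1] [F2 [n1 n2]]]]].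
replace (x / q) with (/ q * x) by (unfold Cdiv; ring).
rewrite F0, F1, F2.
rewrite (Cmult_assoc q (/ q) x), Cinv_r, Cmult_1_l by exact hq.
replace (q ^ 2 * x) with (q * (q * x)) in H by ring.
apply (quotient_equation _ _ _ (q * x - a3) _ (u (q * x)));
  [| | exact U1 | | exact H].
- intros e. apply n2. exact (Cdiv_root _ _ _ (Cpow_nz q 2 hq) e).
- intros e. apply n1. exact (Cdiv_root _ _ _ hq e).
- replace (q ^ 2 * x) with (q * (q * x)) by ring. exact U2.
Qed.
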